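(* Let $\mathcal A,\mathcal B$ be $^*$-algebras over $\mathsf C$ and let $\Phi:\mathcal B\to\mathcal A$ be a $^*$-homomorphism. Let $\mathfrak X=\mathcal A$ with right $\mathcal A$-action by multiplication, left $\mathcal B$-action $B\cdot A=\Phi(B)A$, and inner product $\langle A,A'\rangle_{\mathcal A}=A^*A'$. Then $\mathfrak X$ is a $(\mathcal B$-$\mathcal A)$-bimodule whose $\mathcal A$-valued inner product satisfies X1, X2, X3, X4a, X5 and P. If in addition $\mathcal A$ has an approximate identity, then X6 and P1--P3 are also fulfilled.
   Context: $\mathsf R$ is an ordered ring (commutative ring with $1\ne0$ and a subset $\mathsf P$ closed under sums and products such that $\mathsf R$ is the disjoint union $-\mathsf P\cup\{0\}\cup\mathsf P$), and $\mathsf C=\mathsf R(\mathrm i)=\mathsf R\oplus\mathrm i\mathsf R$, $\mathrm i^2=-1$, with the usual conjugation. A $^*$-algebra over $\mathsf C$ is an associative (not necessarily unital) $\mathsf C$-algebra with an antilinear involution satisfying $(AB)^*=B^*A^*$. $\mathcal A^{++}$ is the set of elements $\sum_{i=1}^n b_iB_i^*B_i$ with $B_i\in\mathcal A$ and $b_i\in\mathsf R$ positive. A pre-Hilbert space over $\mathsf C$ is a $\mathsf C$-module with a Hermitian $\mathsf C$-valued inner product (linear in the second argument), $\langle\phi,\phi\rangle\ge0$, and $\langle\phi,\phi\rangle=0\Rightarrow\phi=0$. A $^*$-representation of $\mathcal A$ is a $^*$-homomorphism into the $^*$-algebra of adjointable endomorphisms of a pre-Hilbert space. Axioms for an $\mathcal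 A$-valued inner product on a $(\mathcal B$-$\mathcal A)$-bimodule $\mathfrak X$: X1) $\mathsf C$-linearity in the second argument; X2) $\langle x,y\rangle_{\mathcal A}=\langle y,x\rangle_{\mathcal A}^*$; X3) $\langle x,y\cdot A\rangle_{\mathcal A}=\langle x,y\rangle_{\mathcal A}A$; X4a) $\langle x,x\rangle_{\mathcal A}\in\mathcal A^{++}$; X5) $\langle x,B\cdot y\rangle_{\mathcal A}=\langle B^*\cdot x,y\rangle_{\mathcal A}$; X6) $\mathcal A$ is the $\mathsf C$-span of all $\langle x,y\rangle_{\mathcal A}$. P) For every $^*$-representation $(\mathfrak H,\pi)$ of $\mathcal A$ the form on $\mathfrak X\otimes_{\mathcal A}\mathfrak H$ (the quotient of $\mathfrak X\otimes_{\mathsf C}\mathfrak H$ by the span of all $x\cdot A\otimes\psi-x\otimes\pi(A)\psi$) determined by $\langle x\otimes\psi,y\otimes\phi\rangle=\langle\psi,\pi(\langle x,y\rangle_{\mathcal A})\phi\rangle$ is positive semi-definite. P1) $\mathfrak X=\bigoplus_{i\in I}\mathfrak X^{(i)}$ with $\mathfrak X^{(i)}\perp\mathfrak X^{(j)}$ for $i\ne j$ with respect to $\langle\cdot,\cdot\rangle_{\mathcal A}$. P2) The right $\mathcal A$-action preserves this direct sum. P3) Each $\mathfrak X^{(i)}$ is pseudo-cyclic: $\mathfrak X^{(i)}=\bigcup_{\alpha\in I^{(i)}}\mathfrak X^{(i)}_\alpha$, a directed union of submodules ($\mathfrak X^{(i)}_\alpha\subseteq\mathfrak X^{(i)}_\beta$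 for $\alpha\le\beta$, $I^{(i)}$ directed), with vectors $\Omega^{(i)}_\alpha\in\mathfrak X^{(i)}_\alpha$ such that every $x\in\mathfrak X^{(i)}_\alpha$ is of the form $\Omega^{(i)}_\alpha\cdot A$ with $A\in\mathcal A$. An approximate identity of $\mathcal A$ is a family $\{\mathcal A_\alpha,E_\alpha\}_{\alpha\in I}$, $I$ directed, with $E_\alpha=E_\alpha^*\in\mathcal A$, $E_\alpha=E_\alpha E_\beta=E_\beta E_\alpha$ for $\alpha<\beta$, submodules $\mathcal A_\alpha\subseteq\mathcal A_\beta$ for $\alpha\le\beta$, $\bigcup_\alpha\mathcal A_\alpha=\mathcal A$, and $E_\alpha A=A=AE_\alpha$ for $A\in\mathcal A_\alpha$. *)

(* Defs.v *)
From HB Require Import structures.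
From mathcomp Require Import all_boot all_order all_algebra.
From mathcomp Require Import generic_quotient ring_quotient sesquilinear.
From mathcomp Require Import mathcomp_extra boolp classical_sets functions.
From mathcomp Require Import complex freeg.

Set Implicit Arguments.
Unset Strict Implicit.
Unset Printing Implicit Defensive.

Import Order.TTheory GRing.Theory Num.Theory.
Local Open Scope ring_scope.
Local Open Scope classical_set_scope.
Local Open Scope quotient_scope.

(* [R[i]] of real_closed is a ring only when [R] is a field; [cring R] is the
   same carrier, with the same operations, over an ordered ring. *)
Definition cring (R : realDomainType) : Type := complex R.

HB.instance Definition _ (R : realDomainType) :=
  GRing.Zmodule.copy (cring R) (complex R).

Section CRing.
Variable R : realDomainType.

Definition creal (x : R) : cring R := Complex x 0.
Definition cconj (z : cring R) : cring R := Complex (complex.Re z) (- complex.Im z).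
(* [z] lies in [R] and is nonnegative there *)
Definition cge0 (z : cring R) : bool := (complex.Im z == 0) && (0 <= complex.Re z).

Fact cring_mul1 : left_id (creal 1) (@ComplexField.mulc R).
Proof. by case=> a b /=; rewrite !mul1r !mul0r subr0 addr0. Qed.

Fact cring_mulDl : left_distributive (@ComplexField.mulc R) +%R.
Proof.
move=> [a b] [c d] [e f]; apply/eqP; rewrite eq_complex /= !mulrDl !opprD.
by rewrite addrACA eqxx addrACA eqxx.
Qed.

Fact cring_1neq0 : creal 1 != 0.
Proof. by rewrite eq_complex /= oner_eq0. Qed.

HB.instance Definition _ := GRing.Zmodule_isComNzRing.Build (cring R)
  (@ComplexField.mulcA R) (@ComplexField.mulcC R)
  cring_mul1 cring_mulDl cring_1neq0.

End CRing.

(* Possibly non-unital $^*$-algebras over [cring R]. *)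
HB.mixin Record Lmodule_isStarAlgebra (R : realDomainType) A
    of GRing.Lmodule (cring R) A := {
  smul : A -> A -> A;
  star : A -> A;
  smulA : associative smul;
  smul_bilinear : bilinear_for *:%R *:%R smul;
  star_antilinear : linear_for (fun c a => cconj c *: a) star;
  starK : involutive star;
  starM : forall a b, star (smul a b) = smul (star b) (star a)
}.

#[short(type="starAlgType")]
HB.structure Definition StarAlgebra (R : realDomainType) :=
  {A of Lmodule_isStarAlgebra R A & GRing.Lmodule (cring R) A}.

Definition star_hom (R : realDomainType) (A B : starAlgType R) (f : A -> B) :=
  [/\ linear f,
      forall a b, f (smul a b) = smul (f a) (f b)
    & forall a, f (star a) = star (f a)].

(* The set $\mathcal A^{++}$ of algebraically positive elements. *)
Definition alg_pos (R : realDomainType) (A : starAlgType R) : set A :=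
  [set a | exists n (b : 'I_n -> R) (B : 'I_n -> A),
     (forall i, 0 < b i) /\
     a = \sum_(i < n) creal (b i) *: smul (star (B i)) (B i)].

HB.mixin Record Lmodule_isPreHilbert (R : realDomainType) H
    of GRing.Lmodule (cring R) H := {
  hip : H -> H -> cring R;
  hip_linear : forall x, linear_for *%R (hip x);
  hip_conj : forall x y, hip x y = cconj (hip y x);
  hip_ge0 : forall x, cge0 (hip x x);
  hip_eq0 : forall x, hip x x = 0 -> x = 0
}.

#[short(type="preHilbertType")]
HB.structure Definition PreHilbert (R : realDomainType) :=
  {H of Lmodule_isPreHilbert R H & GRing.Lmodule (cring R) H}.

Section Adjointable.
Variables (R : realDomainType) (H : preHilbertType R).
Local Notation C := (cring R).

Definition is_adjoint (f g : H -> H) :=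
  forall x y, hip (f x) y = hip x (g y).

Definition adjointable (f : H -> H) : Prop :=
  linear f /\ exists2 g : H -> H, linear g & is_adjoint f g.

Definition adjointable_pred : {pred H -> H} := fun f => `[< adjointable f >].

Lemma cconjK : involutive (@cconj R).
Proof. by case=> a b; rewrite /cconj /= opprK. Qed.

Lemma cconjD : {morph @cconj R : x y / x + y}.
Proof. by case=> a b [c d]; congr Complex; rewrite /= opprD. Qed.

Lemma cconjM : {morph @cconj R : x y / x * y}.
Proof.
case=> a b [c d]; apply/eqP; rewrite eq_complex /= mulrNN mulrN mulNr opprD.
by rewrite !eqxx.
Qed.

Lemma hipDr (x y z : H) : hip x (y + z) = hip x y + hip x z.
Proof. by have := hip_linear x 1 y z; rewrite scale1r mul1r. Qed.

Lemma hip0r (x : H) : hip x 0 = 0.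
Proof. by apply: (addrI (hip x 0)); rewrite -hipDr !addr0. Qed.

Lemma hipZr (c : C) (x y : H) : hip x (c *: y) = c * hip x y.
Proof. by have := hip_linear x c y 0; rewrite hip0r !addr0. Qed.

Lemma hipDl (x y z : H) : hip (x + y) z = hip x z + hip y z.
Proof. by rewrite hip_conj hipDr cconjD -!hip_conj. Qed.

Lemma hipZl (c : C) (x y : H) : hip (c *: x) y = cconj c * hip x y.
Proof. by rewrite hip_conj hipZr cconjM -hip_conj. Qed.

Lemma hip_inj (x y : H) : (forall z, hip z x = hip z y) -> x = y.
Proof.
move=> xy; apply/eqP; rewrite -subr_eq0; apply/eqP; apply: hip_eq0.
by rewrite hipDr xy -hipDr subrr hip0r.
Qed.

Lemma is_adjoint_sym f g : is_adjoint f g -> is_adjoint g f.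
Proof. by move=> fg x y; rewrite hip_conj -fg -hip_conj. Qed.

Lemma is_adjoint_inj f g g' : is_adjoint f g -> is_adjoint f g' -> g = g'.
Proof. by move=> fg fg'; apply/funext => y; apply: hip_inj => z; rewrite -fg. Qed.

Lemma is_adjoint_lin c f f' g g' : is_adjoint f f' -> is_adjoint g g' ->
  is_adjoint (c *: f + g) (cconj c *: f' + g').
Proof. by move=> ff gg x y; rewrite hipDl hipZl hipDr hipZr ff gg. Qed.

Lemma linear_lin (c : C) (f g : H -> H) :
  linear f -> linear g -> linear (c *: f + g).
Proof.
have lin u : (c *: f + g) u = c *: f u + g u by [].
move=> lf lg d x y; rewrite !lin lf lg !scalerDr !scalerA [c * d]mulrC.
by rewrite addrACA.
Qed.

Lemma adjointable_submod : submod_closed adjointable_pred.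
Proof.
have lin0 : linear (0 : H -> H) by move=> c x y; rewrite scaler0 addr0.
split=> [|c f g].
  apply/asboolP; split=> //; exists (0 : H -> H) => // x y.
  by rewrite hip_conj !hip0r; congr Complex; rewrite oppr0.
move=> /asboolP[lf [f' lf' ff']] /asboolP[lg [g' lg' gg']].
apply/asboolP; split; first exact: linear_lin.
exists (cconj c *: f' + g'); first exact: linear_lin.
exact: is_adjoint_lin.
Qed.

HB.instance Definition _ :=
  GRing.isSubmodClosed.Build C (H -> H) adjointable_pred
    (GRing.submod_closed_semi adjointable_submod).

(* The $^*$-algebra of adjointable endomorphisms of [H]. *)
Record adj_end : Type := AdjEnd {
  adj_fun :> H -> H;
  adj_funP : adj_fun \in adjointable_pred
}.

HB.instance Definition _ := [isSub for adj_fun].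
HB.instance Definition _ := [Choice of adj_end by <:].
HB.instance Definition _ := [SubChoice_isSubLmodule of adj_end by <:].

Lemma adj_endP (f : adj_end) : adjointable f.
Proof. exact/asboolP/adj_funP. Qed.

Fact adj_comp_subproof (f g : adj_end) : f \o g \in adjointable_pred.
Proof.
have [lf [f' lf' ff]] := adj_endP f; have [lg [g' lg' gg]] := adj_endP g.
apply/asboolP; split; first by move=> c x y /=; rewrite lg lf.
exists (g' \o f'); first by move=> c x y /=; rewrite lf' lg'.
by move=> x y /=; rewrite ff gg.
Qed.

Definition adj_comp f g : adj_end := AdjEnd (adj_comp_subproof f g).

Fact adj_star_ex (f : adj_end) :
  exists g : adj_end, is_adjoint f g.
Proof.
have [lf [g lg fg]] := adj_endP f.
suff gP : g \in adjointable_pred by exists (AdjEnd gP).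
by apply/asboolP; split=> //; exists f => //; exact: is_adjoint_sym.
Qed.

Definition adj_star (f : adj_end) : adj_end := sval (cid (adj_star_ex f)).

Lemma adj_starP (f : adj_end) : is_adjoint f (adj_star f).
Proof. exact: svalP (cid (adj_star_ex f)). Qed.

Lemma adj_star_uniq (f g : adj_end) : is_adjoint f g -> adj_star f = g.
Proof. by move=> fg; apply/val_inj/(is_adjoint_inj _ fg)/adj_starP. Qed.

Fact adj_compA : associative adj_comp.
Proof. by move=> f g h; apply: val_inj. Qed.

Fact adj_comp_bilinear : bilinear_for *:%R *:%R adj_comp.
Proof.
split=> [g c f f'|f c g g']; first exact: val_inj.
by apply/val_inj/funext => x; have [lf _] := adj_endP f; exact: lf.
Qed.

Fact adj_star_antilinear : linear_for (fun c a => cconj c *: a) adj_star.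
Proof.
by move=> c f g; apply: adj_star_uniq; apply: is_adjoint_lin; exact: adj_starP.
Qed.

Fact adj_starK : involutive adj_star.
Proof. by move=> f; apply/adj_star_uniq/is_adjoint_sym/adj_starP. Qed.

Fact adj_starM f g :
  adj_star (adj_comp f g) = adj_comp (adj_star g) (adj_star f).
Proof.
by apply: adj_star_uniq => x y /=; rewrite adj_starP adj_starP.
Qed.

HB.instance Definition _ := Lmodule_isStarAlgebra.Build R adj_end
  adj_compA adj_comp_bilinear adj_star_antilinear adj_starK adj_starM.

End Adjointable.

Section Span.
Variables (C : comNzRingType) (M : lmodType C).

Definition lspan (G : set M) : set M :=
  [set x | exists n (c : 'I_n -> C) (v : 'I_n -> M),
     (forall k, G (v k)) /\ x = \sum_(k < n) c k *: v k].

Definition submodule (S : set M) :=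
  S 0 /\ forall c x y, S x -> S y -> S (c *: x + y).

Lemma lspan_submodule G : submodule (lspan G).
Proof.
split=> [|c _ _ [n [a [u [Gu ->]]]] [m [b [v [Gv ->]]]]].
  exists 0%N, (fun=> 0), (fun=> 0); split; first by case.
  by rewrite big_ord0.
exists (n + m)%N,
  (fun k => match fintype.split k with inl i => c * a i | inr j => b j end),
  (fun k => match fintype.split k with inl i => u i | inr j => v j end).
split=> [k|]; first by case: fintype.split.
rewrite big_split_ord scaler_sumr; congr (_ + _); apply: eq_bigr => k _.
  by rewrite (unsplitK (inl k)) scalerA.
by rewrite (unsplitK (inr k)).
Qed.

Definition lspan_pred (G : set M) : {pred M} := fun x => `[< lspan G x >].

Fact lspan_submod_closed G : submod_closed (lspan_pred G).
Proof.
have [S0 SL] := lspan_submodule G; split=> [|c x y]; first exact/asboolP.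
by move=> /asboolP Sx /asboolP Sy; apply/asboolP/SL.
Qed.

HB.instance Definition _ G := GRing.isSubmodClosed.Build C M (lspan_pred G)
  (GRing.submod_closed_semi (lspan_submod_closed G)).

(* The quotient module [M / lspan G]. *)
Definition quotmod (G : set M) : Type := Quotient.quot (lspan_pred G).

HB.instance Definition _ G := GRing.Zmodule.on (quotmod G).

Definition quotmod_proj (G : set M) (x : M) : quotmod G :=
  \pi_(Quotient.quot (lspan_pred G)) x.

Definition quotmod_scale G (c : C) (x : quotmod G) : quotmod G :=
  quotmod_proj G (c *: repr (x : Quotient.quot (lspan_pred G))).

Lemma quotmod_projE G x y : quotmod_proj G x = quotmod_proj G y <-> lspan G (x - y).
Proof.
split=> [/eqP|xy]; last apply/eqP.
  by rewrite -Quotient.idealrBE => /asboolP.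
by rewrite -Quotient.idealrBE; apply/asboolP.
Qed.

Lemma quotmod_projD G : {morph quotmod_proj G : x y / x + y}.
Proof. by move=> x y; rewrite /quotmod_proj raddfD. Qed.

Lemma quotmod_reprK G (x : quotmod G) :
  quotmod_proj G (repr (x : Quotient.quot (lspan_pred G))) = x.
Proof. exact: reprK. Qed.

Lemma quotmod_projZ G c x : quotmod_scale c (quotmod_proj G x) = quotmod_proj G (c *: x).
Proof.
apply/quotmod_projE; rewrite -scalerBr.
have [S0 SL] := lspan_submodule G; rewrite -[_ *: _]addr0; apply: SL => //.
exact/quotmod_projE/quotmod_reprK.
Qed.

Fact quotmod_scaleA G a b (v : quotmod G) :
  quotmod_scale a (quotmod_scale b v) = quotmod_scale (a * b) v.
Proof. by rewrite -(quotmod_reprK v) !quotmod_projZ scalerA. Qed.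

Fact quotmod_scale1 G : left_id 1 (@quotmod_scale G).
Proof. by move=> v; rewrite -(quotmod_reprK v) quotmod_projZ scale1r. Qed.

Fact quotmod_scaleDr G : right_distributive (@quotmod_scale G) +%R.
Proof.
move=> a u v; rewrite -(quotmod_reprK u) -(quotmod_reprK v).
by rewrite -quotmod_projD !quotmod_projZ -quotmod_projD scalerDr.
Qed.

Fact quotmod_scaleDl G (v : quotmod G) :
  {morph (@quotmod_scale G)^~ v : a b / a + b}.
Proof.
move=> a b; rewrite -(quotmod_reprK v) !quotmod_projZ -quotmod_projD.
by rewrite scalerDl.
Qed.

HB.instance Definition _ G := GRing.Zmodule_isLmodule.Build C (quotmod G)
  (@quotmod_scaleA G) (@quotmod_scale1 G) (@quotmod_scaleDr G)
  (@quotmod_scaleDl G).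

Lemma quotmod_proj_linear G : linear (quotmod_proj G).
Proof. by move=> c x y; rewrite quotmod_projD -quotmod_projZ. Qed.

End Span.

Section Tensor.
Variables (C : comNzRingType) (X H : lmodType C).
Local Notation F := {freeg (X * H) / C}.

Definition tens_gen (x : X) (h : H) : F := << (x, h) >>.

Definition tens_rel : set F :=
  [set u | exists c x x' h,
     u = tens_gen (c *: x + x') h - (c *: tens_gen x h + tens_gen x' h)] `|`
  [set u | exists c x h h',
     u = tens_gen x (c *: h + h') - (c *: tens_gen x h + tens_gen x h')].

(* $X \otimes_C H$ and its elementary tensors *)
Definition tensC : lmodType C := quotmod tens_rel.
Definition tmulC (x : X) (h : H) : tensC := quotmod_proj tens_rel (tens_gen x h).

Variables (A : Type) (ract : X -> A -> X) (act : A -> H -> H).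

Definition bal_rel : set tensC :=
  [set u | exists x a h, u = tmulC (ract x a) h - tmulC x (act a h)].

(* $X \otimes_A H$ and its elementary tensors, for [A] acting on [X] from the
   right and on [H] from the left *)
Definition tensA : lmodType C := quotmod bal_rel.
Definition tmulA (x : X) (h : H) : tensA := quotmod_proj bal_rel (tmulC x h).

End Tensor.

Section Forms.
Variables (R : realDomainType) (M : lmodType (cring R)).
Local Notation C := (cring R).

Definition sesquilinear_form (F : M -> M -> C) :=
  (forall v, linear_for (fun c z => cconj c * z) (F^~ v)) /\
  (forall u, linear_for *%R (F u)).

Definition pos_semidef (F : M -> M -> C) :=
  (forall u v, F u v = cconj (F v u)) /\ (forall u, cge0 (F u u)).

End Forms.

Section Bimodule.
Variables (R : realDomainType) (B A : starAlgType R) (X : lmodType (cring R)).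
Variables (lact : B -> X -> X) (ract : X -> A -> X) (ip : X -> X -> A).

Definition is_bimodule :=
  [/\ bilinear_for *:%R *:%R lact,
      bilinear_for *:%R *:%R ract,
      forall b b' x, lact (smul b b') x = lact b (lact b' x),
      forall x a a', ract x (smul a a') = ract (ract x a) a'
    & forall b x a, ract (lact b x) a = lact b (ract x a)].

Definition condX1 := forall x, linear (ip x).
Definition condX2 := forall x y, ip x y = star (ip y x).
Definition condX3 := forall x y a, ip x (ract y a) = smul (ip x y) a.
Definition condX4a := forall x, alg_pos (ip x x).
Definition condX5 := forall x y b, ip x (lact b y) = ip (lact (star b) x) y.
Definition condX6 := forall a, lspan [set c | exists x y, c = ip x y] a.

(* [F] is the form on $X \otimes_A H$ induced by [ip] and [pi]. *)
Definition induced_form (H : preHilbertType R) (pi : A -> adj_end H)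
    (F : tensA ract pi -> tensA ract pi -> cring R) :=
  sesquilinear_form F /\
  forall x psi y phi,
    F (tmulA ract pi x psi) (tmulA ract pi y phi) = hip psi (pi (ip x y) phi).

Definition condP := forall (H : preHilbertType R) (pi : A -> adj_end H),
  star_hom pi ->
  exists F, unique (@induced_form H pi) F /\ pos_semidef F.

Definition directed d (J : porderType d) :=
  (exists _ : J, True) /\
  forall a b : J, exists c, (a <= c)%O /\ (b <= c)%O.

Definition internal_direct_sum (I : Type) (Y : I -> set X) :=
  [/\ forall i, submodule (Y i),
      forall x, exists n (i : 'I_n -> I) (y : 'I_n -> X),
        (forall k, Y (i k) (y k)) /\ x = \sum_(k < n) y k
    & forall n (i : 'I_n -> I) (y : 'I_n -> X), injective i ->
        (forall k, Y (i k) (y k)) -> \sum_(k < n) y k = 0 ->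
        forall k, y k = 0].

Definition pseudo_cyclic (Y : set X) :=
  exists d (J : porderType d) (Z : J -> set X) (Omega : J -> X),
    [/\ directed J,
        forall a, submodule (Z a),
        forall a b, (a <= b)%O -> Z a `<=` Z b,
        Y = \bigcup_a Z a
      & forall a, Z a (Omega a) /\
          forall x, Z a x -> exists c : A, x = ract (Omega a) c].

Definition condP1 (I : Type) (Y : I -> set X) :=
  internal_direct_sum Y /\
  forall i j x y, i <> j -> Y i x -> Y j y -> ip x y = 0.
Definition condP2 (I : Type) (Y : I -> set X) :=
  forall i x a, Y i x -> Y i (ract x a).
Definition condP3 (I : Type) (Y : I -> set X) := forall i, pseudo_cyclic (Y i).

End Bimodule.

(* No idempotency of [E a] is assumed: the product relation is for [a < b] only. *)
Definition has_approximate_identity (R : realDomainType) (A : starAlgType R) :=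
  exists d (I : porderType d) (As : I -> set A) (E : I -> A),
    [/\ directed I,
        forall a, star (E a) = E a,
        forall a b, (a < b)%O -> E a = smul (E a) (E b) /\ E a = smul (E b) (E a),
        (forall a, submodule (As a)) /\
        (forall a b, (a <= b)%O -> As a `<=` As b)
      & \bigcup_a As a = setT /\
        forall a x, As a x -> smul (E a) x = x /\ smul x (E a) = x].

(* Main.v *)
Require Import Defs.
From mathcomp Require Import all_boot all_order all_algebra.
From mathcomp Require Import boolp classical_sets.
From mathcomp Require Import generic_quotient freeg.

(** With [x, y |-> x^* y] as inner product, the form induced on [A (x)_A H] is
    the pullback of the inner product of [H] along the multiplication map
    [a (x) psi |-> pi(a) psi], hence it is positive semidefinite.

    For P3, [A] itself is the only summand, filtered by the right ideals
    [E_a A] (rather than by the [A_a], which need not contain [E_a]). *)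

Set Implicit Arguments.
Unset Strict Implicit.
Unset Printing Implicit Defensive.

Import GRing.Theory.
Local Open Scope ring_scope.
Local Open Scope classical_set_scope.

(** * Linear maps, submodules and quotients *)

Section LinearMaps.
Variables (C : comNzRingType) (M N : lmodType C).

Section Props.
Variables (f : M -> N) (lf : linear f).

Lemma linear_propD : {morph f : x y / x + y}.
Proof. by move=> x y; have := lf 1 x y; rewrite !scale1r. Qed.

Lemma linear_prop0 : f 0 = 0.
Proof. by apply: (addrI (f 0)); rewrite -linear_propD !addr0. Qed.

Lemma linear_propZ c x : f (c *: x) = c *: f x.
Proof. by have := lf c x 0; rewrite linear_prop0 !addr0. Qed.

Lemma linear_propB : {morph f : x y / x - y}.
Proof. by move=> x y; rewrite linear_propD -scaleN1r linear_propZ scaleN1r. Qed.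

Lemma linear_ker_submodule : submodule [set x | f x = 0].
Proof.
split=> [|c x y /= fx fy]; first exact: linear_prop0.
by rewrite lf fx fy scaler0 addr0.
Qed.

Lemma linear_preimage_submodule (S : set N) :
  submodule S -> submodule (f @^-1` S).
Proof.
move=> [S0 SL]; split=> [|c x y Sx Sy]; first by rewrite /= linear_prop0.
by rewrite /preimage /= lf; apply: SL.
Qed.

End Props.

Lemma submodule_sum (S : set M) n (v : 'I_n -> M) :
  submodule S -> (forall i, S (v i)) -> S (\sum_(i < n) v i).
Proof.
move=> [S0 SL] Sv; elim/big_rec: _ => // i x _ Sx.
by rewrite -[v i]scale1r; apply: SL.
Qed.

Lemma lspan_sub (G S : set M) : submodule S -> G `<=` S -> lspan G `<=` S.
Proof.
move=> Ssub GS _ [n [c [v [Gv ->]]]]; apply: submodule_sum => // i.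
have [S0 SL] := Ssub; rewrite -[_ *: _]addr0; apply: SL => //; exact: GS.
Qed.

(** Universal property of the quotient. The lift applies [f] to a chosen representative; another
    choice differs by an element of [lspan G], which lies in the kernel of [f]. *)
Lemma quotmod_lift (G : set M) (f : M -> N) :
  linear f -> (forall x, G x -> f x = 0) ->
  exists g : quotmod G -> N,
    linear g /\ forall x, g (quotmod_proj G x) = f x.
Proof.
move=> lf fG; pose g (u : quotmod G) : N :=
  f (repr (u : ring_quotient.Quotient.quot (lspan_pred G))).
have gE x : g (quotmod_proj G x) = f x.
  apply/eqP; rewrite -subr_eq0 -(linear_propB lf); apply/eqP.
  apply: (lspan_sub (linear_ker_submodule lf) fG).
  by apply/quotmod_projE; rewrite quotmod_reprK.
exists g; split=> // c u v.
rewrite -(quotmod_reprK u) -(quotmod_reprK v) -(quotmod_proj_linear G).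
by rewrite !gE lf.
Qed.

End LinearMaps.

(** * Free modules *)

Section FreeModules.
Variables (C : comNzRingType) (K : choiceType) (M : lmodType C).

Lemma freeg_scaleU (c k : C) (x : K) :
  c *: << k *g x >> = << c * k *g x >> :> {freeg K / C}.
Proof. by apply/eqP/freeg_eqP => z; rewrite coeffZ !coeffU mulrA. Qed.

Lemma freeg_submodule_ind (S : set {freeg K / C}) :
  submodule S -> (forall x, S << x >>) -> forall D, S D.
Proof.
move=> [S0 SL] SU D; rewrite -(freeg_sumE D); elim/big_rec: _ => // x E _ SE.
rewrite -[coeff x D]mulr1 -freeg_scaleU; exact: SL.
Qed.

Lemma fglift_linear (f : K -> M) : linear (fglift f).
Proof.
have fB := @lift_is_additive C K M f.
have f0 : fglift f 0 = 0 by rewrite -(subrr 0) fB subrr.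
(* Additivity comes from compatibility with subtraction, through [x + y = x - (0 - y)]. *)
have fD : {morph fglift f : x y / x + y}.
  by move=> x y; rewrite -{1}[y]opprK -[- y]sub0r fB fB f0 sub0r opprK.
(* All scalars are quantified inside the set: at [d *: x] the property for [c] uses the one for
   [c * d] at [x]. *)
have fZ x : [set x | forall c, fglift f (c *: x) = c *: fglift f x] x.
  move: x; apply: freeg_submodule_ind => [|x c].
    split=> [c|d x y /= Zx Zy c]; first by rewrite scaler0 f0 scaler0.
    by rewrite scalerDr scalerA !fD !Zx Zy scalerDr scalerA.
  by rewrite freeg_scaleU !liftU scalerA.
by move=> c x y; rewrite fD fZ.
Qed.

End FreeModules.

(** * Balanced tensor products *)

Section TensorProducts.
Variables (C : comNzRingType) (X H : lmodType C).
Variables (A : Type) (ract : X -> A -> X) (act : A -> H -> H).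

(** Pulling [S] back along both quotient maps gives a submodule of the free module, whose generators
    map to elementary tensors. *)
Lemma tensA_submodule_ind (S : set (tensA ract act)) :
  submodule S -> (forall x h, S (tmulA ract act x h)) -> forall t, S t.
Proof.
move=> Ssub Stmul t; rewrite -(quotmod_reprK t); move: (repr _) => u.
have Su := linear_preimage_submodule (quotmod_proj_linear (bal_rel ract act)) Ssub.
rewrite -(quotmod_reprK u); move: (repr _) => v.
have Sv := linear_preimage_submodule (quotmod_proj_linear (@tens_rel C X H)) Su.
by apply: (freeg_submodule_ind Sv) => -[x h]; exact: Stmul.
Qed.

(** Universal property: extend [f] to the free module, then descend first through the bilinearity
    relations and then through the balancing relations. *)
Lemma tensA_lift (N : lmodType C) (f : X -> H -> N) :
  (forall h, linear (f^~ h)) -> (forall x, linear (f x)) ->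
  (forall x a h, f (ract x a) h = f x (act a h)) ->
  exists g : tensA ract act -> N,
    linear g /\ forall x h, g (tmulA ract act x h) = f x h.
Proof.
move=> lfl lfr fbal.
pose f1 := fglift (fun z : X * H => f z.1 z.2).
have lf1 : linear f1 := fglift_linear _.
have f1U x h : f1 (tens_gen x h) = f x h by rewrite /f1 liftU scale1r.
have [|f2 [lf2 f2E]] := @quotmod_lift C _ N (@tens_rel C X H) f1 lf1.
  move=> u [] [c [x [x' [h ->]]]]; rewrite (linear_propB lf1) lf1 !f1U.
    by rewrite lfl subrr.
  by rewrite lfr subrr.
have [|g [lg gE]] := @quotmod_lift C _ N (bal_rel ract act) f2 lf2.
  by move=> u [x [a [h ->]]]; rewrite (linear_propB lf2) !f2E !f1U fbal subrr.
by exists g; split=> // x h; rewrite gE f2E f1U.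
Qed.

End TensorProducts.

(** * Uniqueness and positivity of the induced form *)

Section InducedForm.
Variables (R : realDomainType) (A : starAlgType R) (X : lmodType (cring R)).
Variables (ract : X -> A -> X) (ip : X -> X -> A).
Variables (H : preHilbertType R) (pi : A -> adj_end H).

(** Taking [e] to be [cconj] or [id] serves the first or the second argument of a sesquilinear
    form. *)
Lemma semilinear_eq_submodule (M : lmodType (cring R)) (e : cring R -> cring R)
    (h h' : M -> cring R) : e 1 = 1 ->
  linear_for (fun c z => e c * z) h -> linear_for (fun c z => e c * z) h' ->
  submodule [set u | h u = h' u].
Proof.
move=> e1 hL hL'; split=> [|c x y /= hx hy]; last by rewrite hL hL' hx hy.
have k0 k : linear_for (fun c z => e c * z) k -> k (0 : M) = 0 :> cring R.
  move=> kL; have := kL 1 0 0; rewrite scaler0 addr0 e1 mul1r => k00.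
  by apply: (addIr (k 0)); rewrite add0r -k00.
by rewrite /= !k0.
Qed.

Lemma cconj1 : cconj (1 : cring R) = 1.
Proof. by congr complex.Complex; rewrite oppr0. Qed.

Lemma induced_form_uniq F F' :
  induced_form (ract := ract) ip (pi := pi) F ->
  induced_form (ract := ract) ip (pi := pi) F' -> F = F'.
Proof.
move=> [[Fl Fr] FE] [[Fl' Fr'] FE']; apply/funext => u; apply/funext => v.
move: u; apply: tensA_submodule_ind.
  exact: (semilinear_eq_submodule cconj1 (Fl v) (Fl' v)).
move=> x psi; move: v; apply: tensA_submodule_ind.
  exact: (semilinear_eq_submodule (e := id) erefl (Fr _) (Fr' _)).
by move=> y phi /=; rewrite FE FE'.
Qed.

(** Symmetry and positivity are inherited from the inner product of [H], whatever the kernel of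
    [T]. *)
Lemma induced_form_pullback (T : tensA ract pi -> H) : linear T ->
  (forall x psi y phi, hip (T (tmulA ract pi x psi)) (T (tmulA ract pi y phi)) =
    hip psi (pi (ip x y) phi)) ->
  exists F, unique (induced_form (ract := ract) ip (pi := pi)) F /\ pos_semidef F.
Proof.
move=> lT TE; exists (fun u v => hip (T u) (T v)); split; last first.
  by split=> [u v|u]; [exact: hip_conj | exact: hip_ge0].
have FI : induced_form (ract := ract) ip (pi := pi) (fun u v => hip (T u) (T v)).
  split=> //; split=> [v c x y|u c x y]; first by rewrite lT hipDl hipZl.
  by rewrite lT hipDr hipZr.
by split=> // F; exact: induced_form_uniq.
Qed.

End InducedForm.

(** * The algebra as a module over itself *)

Section StarAlgebraTheory.
Variables (R : realDomainType) (A : starAlgType R).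

Lemma smul_linearl (a : A) : linear ((@smul R A)^~ a).
Proof. by move=> c x y; have [l _] := @smul_bilinear R A; exact: l. Qed.

Lemma smul_linearr (a : A) : linear (@smul R A a).
Proof. by move=> c x y; have [_ l] := @smul_bilinear R A; exact: l. Qed.

Lemma alg_pos_square (a : A) : alg_pos (smul (star a) a).
Proof.
exists 1%N, (fun=> 1), (fun=> a); split=> [i|]; first exact: Num.Theory.ltr01.
by rewrite big_ord1 scale1r.
Qed.

Lemma condP_smul : condP (fun x a : A => smul x a) (fun x y : A => smul (star x) y).
Proof.
move=> H pi [lpi piM piS].
have lpiE h : linear (fun a => pi a h) by move=> c a b; rewrite lpi.
have lpir a : linear (pi a) by case: (adj_endP (pi a)).
(* The multiplication map is balanced because [pi] is multiplicative. *)
have [|T [lT TE]] := @tensA_lift _ A H A (fun x a => smul x a) pi H _ lpiE lpir.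
  by move=> x a h; rewrite piM.
apply: (induced_form_pullback lT) => x psi y phi.
by rewrite !TE piM piS /= adj_starP.
Qed.

Lemma principal_right_ideal_submodule (a : A) : submodule (range (smul a)).
Proof.
split=> [|c _ _ [x _ <-] [y _ <-]].
  by exists 0 => //; exact: linear_prop0 (smul_linearr a).
by exists (c *: x + y) => //; exact: smul_linearr.
Qed.

(** A common upper bound of [a] and [b] must be [a] itself, by maximality. *)
Lemma directed_maximal_ge d (J : porderType d) (a : J) :
  directed J -> (forall b, ~~ (a < b)%O) -> forall b, (b <= a)%O.
Proof.
move=> [_ dirJ] amax b; have [c [ac bc]] := dirJ a b.
suff -> : a = c by [].
by apply/eqP; move: (amax c); rewrite Order.POrderTheory.lt_neqAle ac andbT negbK.
Qed.

Lemma pseudo_cyclic_approximate_identity :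
  has_approximate_identity A ->
  pseudo_cyclic (fun x a : A => smul x a) [set: A].
Proof.
move=> [d [J [As [E [dirJ Estar EM [Assub Asle] [Asall EA]]]]]].
exists d, J, (fun a => range (smul (E a))), E; split=> //.
- by move=> a; exact: principal_right_ideal_submodule.
(* For [a < b], [E a = E b E a] puts the ideal of [E a] inside that of [E b]. *)
- move=> a b; rewrite Order.POrderTheory.le_eqVlt => /orP[/eqP-> //|ab].
  move=> _ [x _ <-]; have [_ Eab] := EM a b ab.
  by exists (smul (E a) x) => //; rewrite smulA -Eab.
- apply/seteqP; split=> // x _.
  have [a _ xa] : (\bigcup_a As a) x by rewrite Asall.
  by exists a => //; exists x => //; case: (EA a x xa).
(* The generator [E a] has to lie in its own ideal; if some [b] is above [a], then [E a = E a E b]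
   shows it. *)
- move=> a; split=> [|x [y _ <-]]; last by exists y.
  have [[b ab]|amax] := pselect (exists b, (a < b)%O).
    by have [Eab _] := EM a b ab; exists (E b).
  (* [E a] is idempotent even if [a] is maximal: then [a] is a greatest element
     and [As a] is all of [A]. *)
  have [b _ Eb] : (\bigcup_a As a) (E a) by rewrite Asall.
  have ba : (b <= a)%O.
    apply: directed_maximal_ge => // c; apply/negP => ac.
    by apply: amax; exists c.
  by exists (E a) => //; case: (EA a (E a) (Asle b a ba _ Eb)).
Qed.

Lemma condX6_approximate_identity :
  has_approximate_identity A -> condX6 (fun x y : A => smul (star x) y).
Proof.
move=> [d [J [As [E [dirJ Estar EM [Assub Asle] [Asall EA]]]]]] x.
have [a _ xa] : (\bigcup_a As a) x by rewrite Asall.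
have [Ex _] := EA a x xa.
exists 1%N, (fun=> 1), (fun=> x); split=> [k|]; last by rewrite big_ord1 scale1r.
(* Since [E a] is self-adjoint, [x = E a x] is the inner product of [E a] and [x]. *)
by exists (E a), x; rewrite Estar Ex.
Qed.

End StarAlgebraTheory.

Theorem proposition4p8 (R : realDomainType) (A B : starAlgType R)
    (Phi : B -> A) (hPhi : star_hom Phi) :
  let lact := fun (b : B) (x : A) => smul (Phi b) x in
  let ract := fun x a : A => smul x a in
  let ip := fun x y : A => smul (star x) y in
  [/\ is_bimodule lact ract,
      condX1 ip,
      condX2 ip,
      condX3 ract ip
    & [/\ condX4a ip, condX5 lact ip & condP ract ip]] /\
  (has_approximate_identity A ->
    condX6 ip /\
    exists (I : Type) (Y : I -> set A), [/\ condP1 ip Y, condP2 ract Y & condP3 ract Y]).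
Proof.
move=> lact ract ip; have [lPhi PhiM PhiS] := hPhi.
split; last first.
  move=> aiA; split; first exact: condX6_approximate_identity.
  exists unit, (fun=> setT); split=> //; last first.
    by move=> _; exact: pseudo_cyclic_approximate_identity.
  split; last by case=> [] [].
  split=> // [x|n i y inj_i _ y0 k].
    by exists 1%N, (fun=> tt), (fun=> x); rewrite big_ord1.
  (* An injective family of indices in [unit] has at most one member, so the vanishing sum is [y k]
     alone. *)
  have one j : j = k by apply: inj_i; case: (i j); case: (i k).
  by move: y0; rewrite (bigD1 k) //= big1 ?addr0 // => j; rewrite (one j) eqxx.
split.
- split=> [|||x a a'|b x a].
  + split=> [x c b b'|b c x y]; first by rewrite /lact lPhi smul_linearl.
    exact: smul_linearr.
  + split=> [a c x y|x c a b]; first exact: smul_linearl.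
    exact: smul_linearr.
  + by move=> b b' x; rewrite /lact PhiM smulA.
  + exact: smulA.
  + by rewrite /ract /lact smulA.
- by move=> x; exact: smul_linearr.
- by move=> x y; rewrite /ip starM starK.
- by move=> x y a; exact: smulA.
- split; last exact: condP_smul.
    by move=> x; exact: alg_pos_square.
  by move=> x y b; rewrite /ip /lact starM PhiS starK smulA.
Qed.
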